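(* Let $m\ge2$ and let $\beta\in S_{2m}$ be a fixed-point free involution. Then (1) $c(k,\beta)=0$ for every odd integer $k$; (2) $c(2j,\beta)=2^m m!\binom{m}{j}a(j)$ for $j=0,1,2,\dots$.
   Context: $S_{2m}$ is the symmetric group on $[2m]$; $c(k,\beta)$ is the number of $\alpha\in S_{2m}$ with $H(\alpha\beta,\beta\alpha)=k$, where $H(\sigma,\tau)=|\{a:\sigma(a)\ne\tau(a)\}|$. A fixed-point free involution is a product of $m$ disjoint transpositions covering $[2m]$. $a(j)$ is the number of perfect matchings of a set of $2j$ elements (partitions into $j$ pairs) that have no pair in common with a fixed perfect matching of that set (OEIS A053871: $a(0)=1,a(1)=0,a(2)=2,a(3)=8,\dots$); $\binom{m}{j}=0$ for $j>m$. *)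

(* Defs.v *)
From mathcomp Require Import all_boot all_order all_algebra all_fingroup.

Set Implicit Arguments.
Unset Strict Implicit.
Unset Printing Implicit Defensive.

Import GroupScope.

Definition hamming (T : finType) (s t : {perm T}) : nat :=
  #|[set x | s x != t x]|.

(* In MathComp [s * t] applies [s] first, so the two products below are swapped
   with respect to right-to-left composition; [hamming] is symmetric, hence the
   count is the same under both conventions. *)
Definition c (n : nat) (k : int) (beta : 'S_n) : nat :=
  #|[set alpha : 'S_n | Posz (hamming (alpha * beta) (beta * alpha)) == k]|.

Definition entries (T : Type) (s : seq (T * T)) : seq T :=
  flatten [seq [:: p.1; p.2] | p <- s].

(* The [perm_eq] condition says at once that the transpositions are disjoint
   (with distinct entries) and that they cover the whole set. *)
Definition fpf_involution (m : nat) (beta : 'S_(2 * m)) : Prop :=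
  exists t : m.-tuple ('I_(2 * m) * 'I_(2 * m)),
    perm_eq (entries t) (enum 'I_(2 * m)) /\
    beta = \prod_(p <- t) tperm p.1 p.2.

Definition perfect_matching (T : finType) (M : {set {set T}}) : bool :=
  partition M [set: T] && [forall B in M, #|B| == 2].

(* The pairs are {0,1}, {2,3}, ..., {2j-2,2j-1}. *)
Definition std_matching (j : nat) : {set {set 'I_(2 * j)}} :=
  preim_partition (fun x : 'I_(2 * j) => (x : nat)./2) [set: 'I_(2 * j)].

Definition a (j : nat) : nat :=
  #|[set M : {set {set 'I_(2 * j)}} |
      perfect_matching M & [disjoint M & std_matching j]]|.

(* Main.v *)
(** Write [b] for the involution. Composing with [s] shows that [s * b] and
    [b * s] differ at as many points as [b ^ s] and [b] do. The conjugates of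
    [b] are exactly the fixed-point free involutions, and each of them is
    [b ^ s] for [2 ^ m * m`!] choices of [s]. It remains to count the
    fixed-point free involutions [g] that differ from [b] at [2 * j] points: the
    set where they differ is a union of [b]-pairs, chosen in ['C(m, j)] ways, and
    on it [g] is a perfect matching having no pair in common with [b]. *)

Require Import Defs.
From mathcomp Require Import all_boot all_order all_algebra all_fingroup.
From mathcomp Require Import zify.

Set Implicit Arguments.
Unset Strict Implicit.
Unset Printing Implicit Defensive.

(** * Fixed-point free involutions and products of transpositions *)

Definition fpf_inv (T : finType) (g : {perm T}) : bool :=
  [forall x, (g x != x) && (g (g x) == x)].

Lemma fpf_invP (T : finType) (g : {perm T}) :
  reflect ((forall x, g x != x) /\ involutive g) (fpf_inv g).
Proof.
apply: (iffP forallP) => [H | [H1 H2] x]; last by rewrite H1 H2 eqxx.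
by split=> x; have /andP[? /eqP?] := H x.
Qed.

(** By induction on [t]: all entries being distinct, the head transposition fixes every entry of the
    tail, and the tail product fixes both entries of the head. *)
Lemma prod_tperm_entries (T : finType) (t : seq (T * T)) :
  uniq (entries t) ->
  (forall x, x \notin entries t -> (\prod_(p <- t) tperm p.1 p.2)%g x = x) /\
  (forall p, p \in t -> (\prod_(q <- t) tperm q.1 q.2)%g p.1 = p.2 /\
                        (\prod_(q <- t) tperm q.1 q.2)%g p.2 = p.1).
Proof.
elim: t => [_|[u v] t IH]; first by split=> [x _|p //]; rewrite big_nil perm1.
rewrite /entries /= -/(entries t) inE negb_or => /and3P[/andP[uv ut] vt U].
have [IH1 IH2] := IH U; split=> [x|p].
  rewrite !inE !negb_or => /and3P[xu xv xt].
  by rewrite big_cons permM /= tpermD 1?eq_sym // IH1.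
rewrite inE => /predU1P[->|pt] /=.
  by rewrite big_cons !permM /= tpermL tpermR !IH1.
have [p1 p2]: p.1 \in entries t /\ p.2 \in entries t.
  by split; apply/flattenP; exists [:: p.1; p.2];
    rewrite ?inE ?eqxx ?orbT //; apply/mapP; exists p.
have D x : x \in entries t -> tperm u v x = x.
  by move=> xt; rewrite tpermD //; apply: contraTneq xt => <-.
by rewrite big_cons !permM /= !D //; apply: IH2.
Qed.

Lemma fpf_involution_inv (m : nat) (beta : 'S_(2 * m)) :
  fpf_involution beta -> fpf_inv beta.
Proof.
case=> t [Pt ->].
have Ut : uniq (entries t) by rewrite (perm_uniq Pt) enum_uniq.
have [_ H] := prod_tperm_entries Ut.
have D (s : seq ('I_(2 * m) * 'I_(2 * m))) p :
    uniq (entries s) -> p \in s -> p.1 != p.2.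
  elim: s => // q s IH; rewrite /entries /= -/(entries s) inE negb_or.
  move=> /and3P[/andP[qq _] _ Us]; rewrite inE => /predU1P[->//|]; exact: IH.
apply/forallP=> x.
have /flattenP[_ /mapP[p pt ->]]: x \in entries t.
  by rewrite (perm_mem Pt) mem_enum.
have [H1 H2] := H p pt; have pp := D _ _ Ut pt.
by rewrite !inE => /orP[]/eqP->; rewrite ?H1 ?H2 ?H1 eqxx andbT // eq_sym.
Qed.

(** * Pair coordinates and conjugators *)

(** The index names a pair and the boolean one of its two points, so [g] becomes the flip. Such
    coordinates for two involutions of [T] make the permutations conjugating one into the other
    explicit. *)
Lemma fpf_inv_coords (T : finType) (m : nat) (g : {perm T}) :
  #|T| = 2 * m -> fpf_inv g ->
  exists (e : 'I_m * bool -> T) (e' : T -> 'I_m * bool),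
    [/\ cancel e e', cancel e' e & forall i b, g (e (i, b)) = e (i, ~~ b)].
Proof.
move=> Tm /fpf_invP[g_fpf gK].
(* [R] contains exactly one point of each pair [{x, g x}]. *)
pose R := [set x | enum_rank x < enum_rank (g x)].
have gR x : (g x \in R) = (x \notin R).
  rewrite !inE gK -leqNgt ltn_neqAle.
  by rewrite (inj_eq (inj_comp (@ord_inj _) (@enum_rank_inj T))) g_fpf.
have RC : ~: R = g @: R.
  apply/setP=> x; rewrite inE -gR; apply/idP/imsetP=> [gx|[y yR ->]].
    by exists (g x); rewrite ?gK.
  by rewrite gK.
have Rm : #|R| = m.
  have := cardsC R; rewrite RC card_imset ?Tm; [lia|exact: perm_inj].
(* Replacing [m] by [#|R|] lets [enum_val] number the pairs by their representatives in [R]. *)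
move: Rm; case: _ / => {m Tm}.
pose e (u : 'I_#|R| * bool) := if u.2 then g (enum_val u.1) else enum_val u.1.
have e_inj : injective e.
  move=> [i b] [j c]; rewrite /e /=.
  have ne (k l : 'I_#|R|) : g (enum_val k) <> enum_val l :> T.
    move=> E; have := gR (enum_val k).
    by rewrite E !enum_valP.
  case: b; case: c; first by move=> /perm_inj/enum_val_inj->.
  - by move/ne.
  - by move/esym/ne.
  - by move/enum_val_inj->.
have e_bij : bijective e.
  apply: inj_card_bij e_inj _; rewrite card_prod card_ord card_bool.
  by have := cardsC R; rewrite RC card_imset; [lia|exact: perm_inj].
have [e' eK e'K] := e_bij; exists e, e'; split=> // i b.
by rewrite /e; case: b => //=; rewrite gK.
Qed.

Lemma card_conjugators (T : finType) (m : nat) (b g : {perm T}) :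
  #|T| = 2 * m -> fpf_inv b -> fpf_inv g ->
  #|[set s : {perm T} | (b ^ s)%g == g]| = 2 ^ m * m`!.
Proof.
move=> Tm /(fpf_inv_coords Tm)[e [e' [eK e'K be]]].
move=> /(fpf_inv_coords Tm)[f [f' [fK f'K gf]]].
(* In coordinates, an intertwiner permutes the [m] pairs and then flips some of
   them. *)
pose F (u : {perm 'I_m} * {ffun 'I_m -> bool}) x :=
  f (u.1 (e' x).1, (e' x).2 (+) u.2 (e' x).1).
have F_inj u : injective (F u).
  move=> x y /(can_inj fK)[/perm_inj E].
  by rewrite E => /addIb E2; apply: (can_inj e'K); apply/eqP/andP; rewrite E E2.
pose P u := perm (F_inj u).
have -> : [set s : {perm T} | (b ^ s)%g == g] = P @: setT.
  apply/setP=> s; rewrite inE; apply/eqP/imsetP => [bs|[[p q] _ ->]].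
    have sb x : s (b x) = g (s x) by rewrite -bs permJ.
    (* The values at the [false] points determine [s], because [s] intertwines [b] and [g]. *)
    pose p i := (f' (s (e (i, false)))).1.
    pose q := [ffun i => (f' (s (e (i, false)))).2].
    have sE i c : s (e (i, c)) = f (p i, c (+) q i).
      have s0 : s (e (i, false)) = f (p i, q i).
        by rewrite ffunE -surjective_pairing f'K.
      by case: c => //; rewrite -[true]/(~~ false) -be sb s0 gf.
    have p_inj : injective p.
      move=> i j pij.
      (* The boolean [q i] cancels the flip at [i], so both sides equal [f (p i, false)]. *)
      have: s (e (i, q i)) = s (e (j, q j)) by rewrite !sE pij !addbb.
      by move=> /perm_inj/(can_inj eK)[].
    exists (perm p_inj, q) => //; apply/permP=> x.
    by rewrite permE /F /= -{1}[x]e'K [e' x]surjective_pairing sE permE.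
  apply/permP=> y; rewrite -[y](permKV (P (p, q))); move: (_ y) => x {y}.
  have Ex : e' (b x) = ((e' x).1, ~~ (e' x).2).
    by rewrite -{1}[x]e'K {1}[e' x]surjective_pairing be eK.
  by rewrite permJ !permE /F gf Ex /= addNb.
rewrite card_imset ?cardsT ?card_prod ?card_ffun ?card_bool ?card_ord.
  by rewrite mulnC card_Sn.
move=> [p q] [p' q'] /permP E.
have H i : p i = p' i /\ q i = q' i.
  by have := E (e (i, false)); rewrite !permE /F !eK /= => /(can_inj fK)[].
by congr pair; [apply/permP | apply/ffunP] => i; case: (H i).
Qed.

(** * Perfect matchings as involutions *)

Definition matching_of (T : finType) (g : {perm T}) : {set {set T}} :=
  [set [set x; g x] | x : T].

Lemma matching_of_block (T : finType) (g : {perm T}) B x :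
  fpf_inv g -> B \in matching_of g -> x \in B -> B = [set x; g x].
Proof.
move=> /fpf_invP[_ gK] /imsetP[y _ ->]; rewrite !inE => /orP[]/eqP-> //.
by rewrite gK setUC.
Qed.

Lemma matching_of_eq (T : finType) (g g' : {perm T}) x :
  fpf_inv g -> fpf_inv g' -> [set x; g x] \in matching_of g' -> g x = g' x.
Proof.
move=> Hg Hg' H; have := matching_of_block Hg' H (set21 _ _).
have /fpf_invP[g_fpf _] := Hg.
by move/setP/(_ (g x)); rewrite !inE eqxx orbT (negPf (g_fpf x)) => /esym/eqP.
Qed.

Lemma perfect_matching_of (T : finType) (g : {perm T}) :
  fpf_inv g -> perfect_matching (matching_of g).
Proof.
move=> Hg; have /fpf_invP[g_fpf gK] := Hg.
apply/andP; split; last first.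
  by apply/forall_inP=> _ /imsetP[x _ ->]; rewrite cards2 [x == _]eq_sym g_fpf.
apply/and3P; split.
- rewrite eqEsubset subsetT; apply/subsetP=> x _.
  by apply/bigcupP; exists [set x; g x]; [apply: imset_f | apply: set21].
- apply/trivIsetP=> A B HA HB; apply: contraR => /pred0Pn[x /andP[xA xB]].
  by rewrite (matching_of_block Hg HA xA) (matching_of_block Hg HB xB).
- by apply/imsetP=> [[x _ /setP/(_ x)]]; rewrite !inE eqxx.
Qed.

(** Let [g] send each point to the other element of its block; it is an involution because a point
    and its image lie in the same block. *)
Lemma perfect_matchingP (T : finType) (M : {set {set T}}) :
  perfect_matching M -> exists2 g, fpf_inv g & M = matching_of g.
Proof.
move=> /andP[/and3P[/eqP cM tM n0] /forall_inP c2].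
have inM x : pblock M x \in M by rewrite pblock_mem // cM inE.
have xM x : x \in pblock M x by rewrite mem_pblock cM inE.
have /fin_all_exists[g Hg] x : exists y, y != x /\ pblock M x = [set x; y].
  have /cards2P[y [z [yz E]]] := c2 _ (inM x).
  have := xM x; rewrite E !inE => /orP[]/eqP->; first by exists z; rewrite eq_sym.
  by exists y; rewrite setUC.
have gP x : pblock M (g x) = pblock M x.
  by apply: def_pblock => //; case: (Hg x) => _ ->; apply: set22.
have gK : involutive g.
  move=> x; have [nx Ex] := Hg x; have [ny Ey] := Hg (g x).
  move: (gP x); rewrite Ex Ey => /setP/(_ (g (g x))).
  by rewrite !inE eqxx orbT (negPf ny) orbF => /esym/eqP.
exists (perm (inv_inj gK)).
  by apply/fpf_invP; split=> x; rewrite !permE; [case: (Hg x) | apply: gK].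
apply/setP=> B; apply/idP/imsetP=> [BM | [x _ ->]].
  have /cards2P[x [y [_ E]]] := c2 _ BM; exists x => //; rewrite permE.
  by case: (Hg x) => _ <-; rewrite (def_pblock tM BM) // E set21.
by rewrite permE; case: (Hg x) => _ <-.
Qed.

(** The map [matching_of] is a bijection here: a pair [[set x; g x]] is shared with [b] exactly when
    [g x = b x]. *)
Lemma card_disjoint_matchings (T : finType) (b : {perm T}) :
  fpf_inv b ->
  #|[set M : {set {set T}} | perfect_matching M & [disjoint M & matching_of b]]|
  = #|[set g : {perm T} | fpf_inv g & [forall x, g x != b x]]|.
Proof.
move=> Hb; set S := (X in _ = #|X|).
rewrite -(card_in_imset (f := @matching_of T) (D := mem S)).
  apply: eq_card => M; rewrite inE; apply/andP/imsetP => [[]|[g]].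
    move=> /perfect_matchingP[g Hg ->] D; exists g => //.
    rewrite inE Hg; apply/forallP=> x; apply: contraL D => /eqP E.
    apply/pred0Pn; exists [set x; g x]; apply/andP; split; first exact: imset_f.
    by rewrite E; apply: imset_f.
  rewrite inE => /andP[Hg /forallP N] ->; split; first exact: perfect_matching_of.
  apply/pred0P=> B; apply/negP=> /andP[/imsetP[x _ ->]] /(matching_of_eq Hg Hb).
  exact/eqP/N.
move=> g g'; rewrite !inE => /andP[Hg _] /andP[Hg' _] E; apply/permP=> x.
by apply: matching_of_eq => //; rewrite -E; apply: imset_f.
Qed.

(** * Involutions with a prescribed difference set *)

(** The map [h] identifies [U] with a [b]-stable part of [T] on which [b] acts as [c]. Extending [d]
    by [b] outside this part gives [g], and restricting [g] to it recovers [d]. *)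
Lemma card_fpf_inv_transport (T U : finType) (h : U -> T)
    (b : {perm T}) (c : {perm U}) :
  injective h -> fpf_inv b -> fpf_inv c -> (forall u, h (c u) = b (h u)) ->
  #|[set g : {perm T} | fpf_inv g & [set x | g x != b x] == h @: setT]|
  = #|[set d : {perm U} | fpf_inv d & [forall u, d u != c u]]|.
Proof.
move=> h_inj /fpf_invP[b_fpf bK] /fpf_invP[c_fpf cK] hc.
pose F (d : {perm U}) x := if [pick u | h u == x] is Some u then h (d u) else b x.
have Fh d u : F d (h u) = h (d u).
  by rewrite /F; case: pickP => [v /eqP/h_inj-> // | /(_ u)]; rewrite eqxx.
have Fb d x : (forall u, h u != x) -> F d x = b x.
  by rewrite /F; case: pickP => // u /eqP<- /(_ u); rewrite eqxx.
have cases x : (exists u, x = h u) \/ (forall u, h u != x).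
  case: (pickP (fun u => h u == x)) => [u /eqP<-|H]; first by left; exists u.
  by right=> u; rewrite H.
have bout x : (forall u, h u != x) -> forall u, h u != b x.
  by move=> H u; apply: contra (H (c u)) => /eqP E; rewrite hc E bK.
have F_inj d : injective (F d).
  move=> x y; case: (cases x) => [[u ->]|Hx]; case: (cases y) => [[v ->]|Hy].
  - by rewrite !Fh => /h_inj/perm_inj->.
  - by rewrite Fh (Fb _ _ Hy) => /eqP; rewrite (negPf (bout _ Hy _)).
  - by rewrite Fh (Fb _ _ Hx) => /esym/eqP; rewrite (negPf (bout _ Hx _)).
  - by rewrite !Fb // => /perm_inj.
pose P d := perm (F_inj d).
have P_inj : injective P.
  move=> d d' /permP E; apply/permP=> u.
  by have := E (h u); rewrite !permE !Fh => /h_inj.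
rewrite -(card_imset _ P_inj); apply: eq_card => g; rewrite inE.
apply/andP/imsetP => [[/fpf_invP[g_fpf gK] /eqP/setP D]|[d]].
  have gh u : g (h u) != b (h u) by have := D (h u); rewrite inE imset_f.
  have gb x : (forall u, h u != x) -> g x = b x.
    move=> H; apply/eqP; apply: contraT => N.
    have := D x; rewrite inE N => /esym/imsetP[u _ E].
    by have := H u; rewrite E eqxx.
  (* The image of [h] is [g]-stable: if [g (h u)] lay outside, [b] would agree with [g] there and
     send it to [h u], whence [g (h u) = b (h u)], a contradiction. *)
  have /fin_all_exists[d Hd] u : exists v, h v = g (h u).
    case: (cases (g (h u))) => [[v ->]|H]; first by exists v.
    have E := gb _ H; have := gh u; rewrite gK in E.
    by rewrite {2}E bK eqxx.
  have dK : involutive d by move=> u; apply: h_inj; rewrite !Hd gK.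
  exists (perm (inv_inj dK)).
    rewrite inE; apply/andP; split; last first.
      by apply/forallP=> u; rewrite permE -(inj_eq h_inj) Hd hc.
    apply/fpf_invP; split=> u; rewrite !permE //.
    by rewrite -(inj_eq h_inj) Hd.
  apply/permP=> x; rewrite permE; case: (cases x) => [[u ->]|H].
    by rewrite Fh permE Hd.
  by rewrite Fb // gb.
rewrite inE => /andP[/fpf_invP[d_fpf dK] /forallP dc] ->; split.
  apply/fpf_invP; split=> x; rewrite !permE.
    by case: (cases x) => [[u ->]|H]; rewrite ?Fh ?(inj_eq h_inj) // Fb.
  case: (cases x) => [[u ->]|H]; first by rewrite !Fh dK.
  by rewrite (Fb _ _ H) Fb ?bK //; apply: bout.
apply/eqP/setP=> x; rewrite inE permE; case: (cases x) => [[u ->]|H].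
  by rewrite Fh -hc (inj_eq h_inj) dc imset_f.
rewrite Fb // eqxx; apply/esym/imsetP=> [[u _ E]].
by have := H u; rewrite E eqxx.
Qed.

(** * The standard matching *)

Lemma std_swap_proof (j : nat) (x : 'I_(2 * j)) :
  (if odd x then x.-1 else x.+1) < 2 * j.
Proof. by case: x => x /=; case: ifP; lia. Qed.

Definition std_swap j x : 'I_(2 * j) := Ordinal (std_swap_proof x).

Lemma std_swapK j : involutive (@std_swap j).
Proof. by move=> x; apply: val_inj => /=; case: (boolP (odd x)) => ox; case: ifP; lia. Qed.

Definition std_inv j : 'S_(2 * j) := perm (inv_inj (@std_swapK j)).

Lemma fpf_std_inv j : fpf_inv (std_inv j).
Proof.
apply/fpf_invP; split=> x; rewrite !permE; last exact: std_swapK.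
by rewrite -val_eqE /=; case: ifP; lia.
Qed.

(** Two numbers have the same half exactly when they are equal or exchanged by the parity swap. *)
Lemma std_matchingE j : std_matching j = matching_of (std_inv j).
Proof.
have H (x : 'I_(2 * j)) :
    [set y : 'I_(2 * j) in setT | x./2 == y./2] = [set x; std_inv j x].
  by apply/setP=> y; rewrite !inE permE -!val_eqE /=; case: ifP; lia.
by apply/setP=> B; apply/imsetP/imsetP => [][x _ ->]; exists x; rewrite ?inE //= H.
Qed.

Lemma aE j :
  a j = #|[set g : 'S_(2 * j) | fpf_inv g & [forall x, g x != std_inv j x]]|.
Proof. by rewrite -card_disjoint_matchings ?fpf_std_inv // -std_matchingE. Qed.

(** * Counting involutions by Hamming distance *)

(** If [g] and [b] agree at one point of a [b]-pair they exchange its two points, so they agree at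
    the other; testing the [false] point of each pair suffices. *)
Lemma diff_fpf_inv (T : finType) (m : nat) (b : {perm T})
    (e : 'I_m * bool -> T) (e' : T -> 'I_m * bool) (g : {perm T}) :
  cancel e' e -> cancel e e' ->
  (forall i c, b (e (i, c)) = e (i, ~~ c)) -> fpf_inv g ->
  [set x | g x != b x] =
  e @: setX [set i | g (e (i, false)) != b (e (i, false))] setT.
Proof.
move=> e'K eK be /fpf_invP[_ gK]; apply/setP=> x.
rewrite -[x]e'K mem_imset; last exact: can_inj eK.
case: (e' x) => i c; rewrite !inE andbT /=.
case: c => //; congr negb; rewrite !be /=.
by apply/eqP/eqP => <-; rewrite gK.
Qed.

Lemma card_diff_fpf_inv (T : finType) (m : nat) (b : {perm T}) :
  #|T| = 2 * m -> fpf_inv b ->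
  (forall g, fpf_inv g -> ~~ odd (hamming g b)) /\
  (forall j, #|[set g | fpf_inv g & hamming g b == 2 * j]| = 'C(m, j) * a j).
Proof.
move=> Tm Hb; have [e [e' [eK e'K be]]] := fpf_inv_coords Tm Hb.
pose E (g : {perm T}) := [set i | g (e (i, false)) != b (e (i, false))].
have dE g : fpf_inv g -> [set x | g x != b x] = e @: setX (E g) setT.
  exact: diff_fpf_inv.
have e_inj := can_inj eK.
have hE g : fpf_inv g -> hamming g b = 2 * #|E g|.
  by move=> Hg; rewrite /hamming dE // card_imset // cardsX cardsT card_bool mulnC.
split=> [g Hg|j]; first by rewrite hE // oddM.
(* The [g] are sorted by the set [A] of pairs on which they differ from [b]; each [A] of size [j]
   will contribute [a j]. *)
rewrite -sum1_card (partition_big E (fun A => #|A| == j)) /=; last first.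
  by move=> g; rewrite inE => /andP[Hg]; rewrite hE // eqn_mul2l.
have -> : 'C(m, j) * a j = \sum_(A : {set 'I_m} | #|A| == j) a j.
  rewrite sum_nat_const -[X in 'C(X, _)]card_ord -card_draws.
  by congr (_ * _); apply: eq_card => A; rewrite !inE.
apply: eq_bigr => A /eqP; case: _ /.
have half_lt (k : 'I_(2 * #|A|)) : k./2 < #|A| by case: k => k /=; lia.
(* The standard pair of [2i] and [2i+1] goes to the [i]-th pair of [A], with parity as the boolean,
   so that [std_inv] corresponds to [b]. *)
pose h (k : 'I_(2 * #|A|)) := e (enum_val (Ordinal (half_lt k)), odd k).
have h_inj : injective h.
  move=> k l /e_inj[/enum_val_inj[kl] o]; apply: ord_inj.
  by rewrite -(odd_double_half k) -(odd_double_half l) o kl.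
have hb k : h (std_inv #|A| k) = b (h k).
  rewrite be permE /h; congr (e (enum_val _, _)); last by rewrite /=; case: ifP; lia.
  by apply: ord_inj => /=; case: ifP; lia.
have hT : h @: setT = e @: setX A setT.
  apply/eqP; rewrite eqEcard !card_imset // cardsX !cardsT card_ord card_bool.
  rewrite [#|A| * 2]mulnC leqnn andbT; apply/subsetP=> _ /imsetP[k _ ->].
  by apply: imset_f; rewrite !inE enum_valP.
rewrite aE -(card_fpf_inv_transport h_inj Hb (fpf_std_inv _) hb) -sum1_card.
apply: eq_bigl => g; rewrite !inE; case Hg: (fpf_inv g) => //=.
rewrite hE // dE // hT (inj_eq (imset_inj e_inj)).
apply/andP/eqP => [[_ /eqP-> //] | /setP EA].
suff -> : E g = A by [].
by apply/setP=> i; have := EA (i, true); rewrite !in_setX !in_setT !andbT.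
Qed.

(** * From commutation to conjugation *)

(** At [x] the two products give [b (s x)] and [s (b x) = (b ^ s) (s x)], so [s] maps the first
    difference set onto the second. *)
Lemma hamming_mulC (T : finType) (s b : {perm T}) :
  hamming (s * b)%g (b * s)%g = hamming (b ^ s)%g b.
Proof.
rewrite /hamming -(card_imset _ (@perm_inj _ s)).
apply: eq_card => y; rewrite -[y](permKV s); move: (_ y) => x {y}.
by rewrite mem_imset ?inE; [rewrite permJ !permM eq_sym | apply: perm_inj].
Qed.

Lemma fpf_invJ (T : finType) (b s : {perm T}) : fpf_inv b -> fpf_inv (b ^ s)%g.
Proof.
move=> /fpf_invP[b_fpf bK]; apply/fpf_invP.
by split=> y; rewrite -[y](permKV s) !permJ ?bK // (inj_eq perm_inj).
Qed.

Theorem theorem7 (m : nat) (hm : 2 <= m) (beta : 'S_(2 * m))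
    (hbeta : fpf_involution beta) :
  (forall k : int, ~~ (2 %| k)%Z -> c k beta = 0) /\
  (forall j : nat, c (Posz (2 * j)) beta = 2 ^ m * m`! * 'C(m, j) * a j).
Proof.
have Hb := fpf_involution_inv hbeta.
have Tm : #|'I_(2 * m)| = 2 * m by rewrite card_ord.
have [even_diff card_diff] := card_diff_fpf_inv Tm Hb.
split=> [k k_odd | j].
  apply/eqP; rewrite cards_eq0; apply/eqP/setP=> s; rewrite !inE hamming_mulC.
  apply: contraNF k_odd => /eqP<-.
  by have := even_diff _ (fpf_invJ s Hb); lia.
rewrite -mulnA -card_diff [RHS]mulnC -sum_nat_const /c -sum1_card.
rewrite (partition_big (fun s => (beta ^ s)%g)
  (mem [set g | fpf_inv g & hamming g beta == 2 * j])) /=; last first.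
  by move=> s; rewrite !inE hamming_mulC fpf_invJ.
apply: eq_bigr => g; rewrite inE => /andP[Hg dg].
rewrite -(card_conjugators Tm Hb Hg) -sum1_card; apply: eq_bigl => s.
rewrite !inE hamming_mulC andbC; case: eqP => //= ->; exact: dg.
Qed.
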